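(* For integers $n \ge 2$ let $A_n = \big((2n+2)^{n/2} + 2n^{n/2}\big)^{2/n}$ and $B_n = 2^{2/n}(2n+2)$. Then $A_n/B_n$ is strictly smaller than $1$ for every $n\ge 2$, and $A_n/B_n \to 1$ as $n\to\infty$. *)

(* Defs.v *)
(* Stdlib reals; limits as in Coquelicot. *)
From Stdlib Require Import Reals.
From Coquelicot Require Import Coquelicot.
Open Scope R_scope.

(* [Rpower x y] is the real power x^y for x > 0.  For n >= 1 every base below is
   positive; the values at n = 0 are irrelevant. *)
Definition A (n : nat) : R :=
  Rpower (Rpower (2 * INR n + 2) (INR n / 2) + 2 * Rpower (INR n) (INR n / 2))
         (2 / INR n).

Definition B (n : nat) : R :=
  Rpower 2 (2 / INR n) * (2 * INR n + 2).

(* Main.v *)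
Require Import Defs.
From Stdlib Require Import Reals Lra.
From Coquelicot Require Import Coquelicot.
Open Scope R_scope.

(** Write P = (2n+2)^(n/2) and Q = n^(n/2), so that A n = (P + 2Q)^(2/n) and
    B n = (2P)^(2/n).  For n >= 2 the exponent n/2 is at least 1, hence
    2Q <= 2^(n/2) Q = (2n)^(n/2) < P, and A n < B n follows by monotonicity of
    the power.  In the other direction A n >= P^(2/n) = 2n+2, which gives
    A n / B n >= 2^(-2/n).  Since 2^(-2/n) tends to 1, the limit of the ratio
    is obtained by squeezing it between this bound and 1. *)

Lemma Rpower_pos (x y : R) : 0 < Rpower x y.
Proof. apply exp_pos. Qed.

Lemma Rpower_half_two_div (x n : R) :
  0 < x -> 0 < n -> Rpower (Rpower x (n / 2)) (2 / n) = x.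
Proof.
  intros hx hn. rewrite Rpower_mult.
  replace (n / 2 * (2 / n)) with 1 by (field; lra).
  now apply Rpower_1.
Qed.

Lemma INR_ge_2 (n : nat) : (2 <= n)%nat -> 2 <= INR n.
Proof. intros hn. apply le_INR in hn. simpl in hn. lra. Qed.

Lemma B_pos (n : nat) : 0 < B n.
Proof.
  unfold B. apply Rmult_lt_0_compat; [apply Rpower_pos|].
  pose proof (pos_INR n). lra.
Qed.

Lemma B_as_power (n : nat) :
  (2 <= n)%nat ->
  B n = Rpower (2 * Rpower (2 * INR n + 2) (INR n / 2)) (2 / INR n).
Proof.
  intros hn. apply INR_ge_2 in hn. unfold B.
  rewrite <- Rpower_mult_distr by (try apply Rpower_pos; lra).
  rewrite Rpower_half_two_div by lra. reflexivity.
Qed.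

Lemma two_mul_Rpower_lt (x : R) :
  2 <= x -> 2 * Rpower x (x / 2) < Rpower (2 * x + 2) (x / 2).
Proof.
  intros hx.
  apply Rle_lt_trans with (Rpower (2 * x) (x / 2)).
  - rewrite <- Rpower_mult_distr by lra.
    apply Rmult_le_compat_r; [apply Rlt_le, Rpower_pos|].
    rewrite <- (Rpower_1 2) at 1 by lra.
    apply Rle_Rpower; lra.
  - apply Rlt_Rpower_l; lra.
Qed.

Lemma A_div_B_lt_1 (n : nat) : (2 <= n)%nat -> A n / B n < 1.
Proof.
  intros hn. apply Rlt_div_l; [apply B_pos|].
  rewrite Rmult_1_l, B_as_power by assumption.
  apply INR_ge_2 in hn. unfold A.
  pose proof (two_mul_Rpower_lt (INR n) hn).
  pose proof (Rpower_pos (INR n) (INR n / 2)).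
  apply Rlt_Rpower_l; [apply Rdiv_lt_0_compat; lra | lra].
Qed.

Lemma A_div_B_lower (n : nat) :
  (2 <= n)%nat -> Rpower 2 (- (2 / INR n)) <= A n / B n.
Proof.
  intros hn. apply Rle_div_r; [apply B_pos|].
  apply INR_ge_2 in hn. unfold B.
  rewrite <- Rmult_assoc, <- Rpower_plus, Rplus_opp_l, Rpower_O, Rmult_1_l by lra.
  rewrite <- (Rpower_half_two_div (2 * INR n + 2) (INR n)) at 1 by lra.
  unfold A.
  pose proof (Rpower_pos (INR n) (INR n / 2)).
  pose proof (Rpower_pos (2 * INR n + 2) (INR n / 2)).
  apply Rle_Rpower_l; [apply Rlt_le, Rdiv_lt_0_compat; lra | lra].
Qed.

Lemma is_lim_seq_Rpower_opp_div (x c : R) :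
  is_lim_seq (fun n : nat => Rpower x (- (c / INR n))) 1.
Proof.
  unfold Rpower. rewrite <- exp_0.
  apply (is_lim_seq_continuous exp (fun n : nat => - (c / INR n) * ln x) 0).
  - apply derivable_continuous_pt, derivable_pt_exp.
  - apply is_lim_seq_ext with (fun n : nat => (- c * ln x) * / INR n).
    { intros n. unfold Rdiv. ring. }
    replace (Finite 0) with (Rbar_mult (- c * ln x) 0)
      by (simpl; f_equal; ring).
    apply is_lim_seq_scal_l.
    replace (Finite 0) with (Rbar_inv p_infty) by reflexivity.
    apply is_lim_seq_inv; [apply is_lim_seq_INR | discriminate].
Qed.

Theorem lemma19 :
  (forall n : nat, (2 <= n)%nat -> A n / B n < 1) /\
  is_lim_seq (fun n : nat => A n / B n) 1.
Proof.
  split; [exact A_div_B_lt_1|].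
  apply is_lim_seq_le_le_loc with
    (u := fun n : nat => Rpower 2 (- (2 / INR n))) (w := fun _ => 1).
  - exists 2%nat. intros n hn.
    split; [now apply A_div_B_lower | now apply Rlt_le, A_div_B_lt_1].
  - apply is_lim_seq_Rpower_opp_div.
  - apply is_lim_seq_const.
Qed.
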